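(* Let $K$ be a finite field with $|K|=q$, let $W$ be a $K$-vector space of dimension greater than one, and let $m=q+1$. Let $\mathcal{U}=(U_1,\dots,U_m)$ and $\mathcal{V}=(V_1,\dots,V_m)$ be tuples of finite-dimensional subspaces of $W$ such that $(\mathcal{U},\mathcal{V})$ is a nontrivial solution of the isometry equation $$\sum_{i=1}^m \frac{1}{|V_i|}\mathbb{1}_{V_i}=\sum_{i=1}^m \frac{1}{|U_i|}\mathbb{1}_{U_i}.$$ Then for any $i\neq j$ in $\{1,\dots,m\}$ and any $k\in\{1,\dots,m\}$, $V_k\subseteq V_i+V_j$ and $U_k\subseteq V_i+V_j$. Moreover, for any $i\neq j$ in $\{1,\dots,m\}$, $$\dim_K(V_i+V_j)\le 2+\max_{1\le l\le m}\dim_K V_l.$$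
   Context: For a subset $X\subseteq W$, $\mathbb{1}_X:W\to\{0,1\}$ is the indicator function of $X$; the isometry equation is an equality of functions on $W$. Tuples $\mathcal{U},\mathcal{V}$ of length $m$ are equivalent, $\mathcal{U}\sim\mathcal{V}$, if there is a permutation $\pi\in S_m$ with $V_i=U_{\pi(i)}$ for all $i\in\{1,\dots,m\}$. A pair $(\mathcal{U},\mathcal{V})$ is a solution if it satisfies the isometry equation; a solution is trivial if $\mathcal{U}\sim\mathcal{V}$ and nontrivial otherwise. *)

(* Defs.v *)
From mathcomp Require Import all_boot all_order all_algebra perm.
From mathcomp Require Import finmap.
From mathcomp Require Import boolp classical_sets functions cardinality.
From mathcomp Require Import numfun.

Set Implicit Arguments.
Unset Strict Implicit.
Unset Printing Implicit Defensive.

Import GRing.Theory.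
Local Open Scope classical_set_scope.
Local Open Scope card_scope.
Local Open Scope ring_scope.

(* The ambient space is an arbitrary [lmodType], since it need not be finite
   dimensional ([vectType] would force that); its subspaces are [set]s, and
   bases are sets of vectors. *)
Section LinearAlgebra.
Variables (K : fieldType) (W : lmodType K).
Implicit Types A B V : set W.

Definition is_subspace V : Prop := GRing.submod_closed [in V].

Definition lin_span B : set W :=
  [set w | exists (s : {fset W}) (a : W -> K),
     [set` s] `<=` B /\ w = \sum_(x <- s) a x *: x].

Definition lin_indep B : Prop :=
  forall (s : {fset W}) (a : W -> K), [set` s] `<=` B ->
    \sum_(x <- s) a x *: x = 0 -> forall x, x \in s -> a x = 0.

Definition is_basis V B : Prop := lin_indep B /\ lin_span B = V.

Definition fin_dim V : Prop := exists2 B, finite_set B & is_basis V B.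

(* Meaningful for finite-dimensional subspaces only: [fset_set] of an infinite
   set is empty, and so is the default value of [xget]. *)
Definition subspace_dim V : nat := #|` fset_set (xget set0 [set B | is_basis V B])|.

(* The full space W may be infinite dimensional, so its dimension is compared
   with 1 as a cardinal. *)
Definition full_dim_gt1 : Prop :=
  exists2 B, is_basis [set: W] B & ~ (B #<= `I_1).

Definition sum_space A B : set W := [set x + y | x in A & y in B].

End LinearAlgebra.

Section IsometryEquation.
Variables (K : finFieldType) (W : lmodType K) (m : nat).
Implicit Types U V : 'I_m -> set W.

(* [fset_set X] has the same elements as X whenever X is finite, as are all
   finite-dimensional subspaces over a finite field. *)
Definition weighted_indicator_sum U : W -> rat :=
  fun w => \sum_(i < m) (#|` fset_set (U i)|%:R)^-1 * \1_(U i) w.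

Definition isometry_equation U V : Prop :=
  weighted_indicator_sum V = weighted_indicator_sum U.

Definition tuple_equiv U V : Prop :=
  exists p : 'S_m, forall i, V i = U (p i).

Definition nontrivial_solution U V : Prop :=
  isometry_equation U V /\ ~ tuple_equiv U V.

End IsometryEquation.

(* Main.v *)
From HB Require Import structures.
Require Import Defs.
From mathcomp Require Import all_boot all_order all_algebra perm mxabelem zify.

Set Implicit Arguments.
Unset Strict Implicit.
Unset Printing Implicit Defensive.

Import GRing.Theory Num.Theory.

(* Present all the subspaces as row spaces in a coordinate space F^n and pass to
   annihilators. Summing the isometry equation over the hyperplane f = 0 shows
   that every functional f lies in as many of the A_i = V_i^perp as of the
   B_i = U_i^perp. No family of at most q proper subspaces covers a subspace, so
   A_i <> B_j for all i, j. If A_i lies in no B_j, the q + 1 proper subspaces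
   A_i /\ B_j cover A_i; this forces them to be hyperplanes of A_i with a common
   pairwise intersection of codimension 2, contained in every A_k and B_k. Hence
   all A_i /\ A_j with i <> j equal the common core of the two families, which has
   codimension at most 2 in each member. Dualizing again gives the theorem. *)

(** * Coverings of a vector space by subspaces *)

Section Covers.
Variables (F : finFieldType) (n : nat).
Implicit Types X Y M : {set 'rV[F]_n}.

Definition linear_set X : Prop := exists A : 'M[F]_n, X = rowg A.

Lemma linear_set_card X : linear_set X -> exists d, #|X| = #|F| ^ d.
Proof. by case=> A ->; exists (\rank A); rewrite card_rowg. Qed.

Lemma linear_set0 X : linear_set X -> 0%R \in X.
Proof. by case=> A ->; rewrite mem_rowg sub0mx. Qed.

Lemma linear_cardD1 X : linear_set X -> #|X| = #|X :\ 0%R|.+1.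
Proof. by move=> /linear_set0 X0; rewrite (cardsD1 0%R) X0. Qed.

Lemma linear_setI X Y : linear_set X -> linear_set Y -> linear_set (X :&: Y).
Proof. by case=> A -> [B ->]; exists (A :&: B)%MS; rewrite rowgI. Qed.

Lemma finField_gt1 : 1 < #|F|.
Proof. exact: card_finNzRing_gt1. Qed.

Lemma leq_expn_mul a b : #|F| ^ a < #|F| ^ b -> #|F| * #|F| ^ a <= #|F| ^ b.
Proof.
by rewrite ltn_exp2l ?finField_gt1// -expnS leq_exp2l ?finField_gt1.
Qed.

Lemma linear_proper_card X Y : linear_set X -> linear_set Y ->
  X \proper Y -> #|F| * #|X| <= #|Y|.
Proof.
move=> /linear_set_card[a ea] /linear_set_card[b eb] /proper_card.
by rewrite ea eb; exact: leq_expn_mul.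
Qed.

(** This is dim X + dim Y = dim (X + Y) + dim (X /\ Y) in multiplicative form, with X + Y bounded by
    [M]. *)
Lemma linear_capI_card X Y M : linear_set X -> linear_set Y -> linear_set M ->
  X \subset M -> Y \subset M -> #|X| * #|Y| <= #|M| * #|X :&: Y|.
Proof.
move=> [A ->] [B ->] [C ->]; rewrite !rowgS -rowgI !card_rowg => AC BC.
rewrite -!expnD leq_exp2l ?finField_gt1// -mxrank_sum_cap leq_add2r.
by apply: mxrankS; rewrite addsmx_sub AC.
Qed.

Lemma sum_card_incidence (T I : finType) (D : I -> {set T}) (S : {set T}) :
  (forall i, D i \subset S) ->
  \sum_i #|D i| = \sum_(x in S) #|[set i | x \in D i]|.
Proof.
move=> DS; under eq_bigr => i _.
  rewrite -sum1_card big_mkcond (bigID (mem S)) /= [X in _ + X]big1 ?addn0.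
    over.
  by move=> x xS; case: ifP => // /(subsetP (DS i)) xS'; rewrite xS' in xS.
rewrite exchange_big /=; apply: eq_bigr => x xS.
by rewrite -big_mkcond /= sum1dep_card.
Qed.

Lemma card_cover_leq (T I : finType) (D : I -> {set T}) (S : {set T}) :
  (forall i, D i \subset S) -> (forall x, x \in S -> exists i, x \in D i) ->
  #|S| <= \sum_i #|D i|.
Proof.
move=> DS cS; rewrite (sum_card_incidence DS) -sum1_card leq_sum// => x xS.
by apply/card_gt0P; have [i xi] := cS x xS; exists i; rewrite inE.
Qed.

(** In the double count each point of [S] contributes at least 1, and [x] contributes at least 2. *)
Lemma card_overcover_ltn (T I : finType) (D : I -> {set T}) (S : {set T})
    (x : T) (j k : I) :
  (forall i, D i \subset S) -> (forall x, x \in S -> exists i, x \in D i) ->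
  j != k -> x \in D j -> x \in D k -> #|S| < \sum_i #|D i|.
Proof.
move=> DS cS jk xj xk; rewrite (sum_card_incidence DS) -sum1_card.
have xS : x \in S by exact: subsetP (DS j) _ xj.
rewrite (bigD1 x)//= [X in _ < X](bigD1 x)//= -addSn leq_add//.
  by apply/card_gt1P; exists j, k; rewrite !inE.
rewrite leq_sum// => y /andP[yS _].
by apply/card_gt0P; have [i yi] := cS y yS; exists i; rewrite inE.
Qed.

(** A proper subspace has at most |M|/q - 1 nonzero vectors, so q of them reach at most |M| - q of
    the |M| - 1 nonzero vectors of [M]. *)
Lemma linear_cover_gt (I : finType) (H : I -> {set 'rV[F]_n}) M :
  linear_set M -> (forall i, linear_set (H i)) ->
  (forall i, H i \proper M) -> (forall x, x \in M -> exists i, x \in H i) ->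
  #|F| < #|I|.
Proof.
move=> linM linH pH cH; rewrite ltnNge; apply/negP => Iq.
have q1 := finField_gt1.
have hH i : #|F| * #|H i| <= #|M| by apply: linear_proper_card.
(* This keeps the truncated subtraction [#|M| - #|F|] below faithful. *)
have qM : #|F| <= #|M|.
  have [i i0] := cH _ (linear_set0 linM).
  apply: leq_trans (hH i); rewrite -{1}[#|F|]muln1 leq_mul2l.
  by apply/orP; right; apply/card_gt0P; exists 0%R.
have : #|M :\ 0%R| <= \sum_i #|H i :\ 0%R|.
  apply: card_cover_leq => [i|x]; first by rewrite setSD// proper_sub.
  by rewrite !inE => /andP[x0 /cH[i xi]]; exists i; rewrite !inE x0.
rewrite leqNgt => /negP; apply.
rewrite -(ltn_pmul2l (ltnW q1)) big_distrr /=.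
apply: (@leq_ltn_trans (\sum_(i : I) (#|M| - #|F|))).
  apply: leq_sum => i _; have := hH i.
  by rewrite (linear_cardD1 (linH i)) mulnS -leq_subRL.
rewrite sum_nat_const; have eM := linear_cardD1 linM.
apply: (@leq_ltn_trans (#|F| * (#|M| - #|F|))); first by rewrite leq_mul2r Iq orbT.
by rewrite ltn_pmul2l ?(ltnW q1)// ltn_subLR// eM -[X in X < _]add1n ltn_add2r.
Qed.

(* Counting [M \ H i] shows that every member is a hyperplane and that
   distinct members are disjoint outside [H i]. *)
Lemma linear_cover_tight (I : finType) (H : I -> {set 'rV[F]_n}) M :
  linear_set M -> (forall i, linear_set (H i)) ->
  (forall i, H i \proper M) -> (forall x, x \in M -> exists i, x \in H i) ->
  #|I| = #|F| + 1 ->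
  (forall i j, i != j -> #|M| <= #|F| ^ 2 * #|H i :&: H j|) /\
  (forall i j k, i != j -> H i :&: H j \subset H k).
Proof.
move=> linM linH pH cH Iq; have q1 := finField_gt1.
have hH i : #|F| * #|H i| <= #|M| by apply: linear_proper_card.
have sH i : H i \subset M by apply: proper_sub.
have M0 : 0 < #|M| by apply/card_gt0P; exists 0%R; apply: linear_set0.
(* Orders are powers of q, so if no member had index q, each would have at most |M|/q^2 elements. A
   cover by q + 1 of them would give q^2 <= q + 1, which is false for q >= 2. *)
have [i0 /eqP hi0] : exists i, #|F| * #|H i| == #|M|.
  apply/existsP; apply: contraT; rewrite negb_exists => /forallP nh.
  have hH2 i : #|F| * (#|F| * #|H i|) <= #|M|.
    have [a ea] := linear_set_card (linH i).
    have [b eb] := linear_set_card linM.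
    have := hH i; rewrite ea eb -expnS => le; apply: leq_expn_mul.
    rewrite ltn_neqAle le andbT; have := nh i.
    by rewrite ea eb -expnS.
  have cM := card_cover_leq sH cH.
  have : #|F| * (#|F| * #|M|) <= (#|F| + 1) * #|M|.
    rewrite -Iq -[#|I| * _]sum_nat_const.
    apply: (@leq_trans (#|F| * (#|F| * \sum_i #|H i|))).
      by rewrite !leq_mul2l cM !orbT.
    by rewrite !big_distrr /=; apply: leq_sum => i _.
  rewrite mulnA leq_pmul2r//; nia.
have key i : #|F| * #|H i| = #|M| ->
    (forall j, #|H j| = #|H i|) /\
    forall j k, j != k -> H j :&: H k \subset H i.
  move=> hi; have h0 : 0 < #|H i| by nia.
  pose D j := H j :\: H i.
  have DM j : D j \subset M :\: H i by rewrite setSD.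
  have cD x : x \in M :\: H i -> exists j, x \in D j.
    by rewrite !inE => /andP[xi /cH[j xj]]; exists j; rewrite !inE xi.
  have hj j : #|H j| <= #|H i| by rewrite -(leq_pmul2l (ltnW q1)) hi.
  (* As [H i] has index q in [M], it contains at least 1/q of [H j]. The q sets [D j] with [j != i]
     thus have at most (q - 1)|H i| elements in total, exactly the size of [M :\: H i]: a smaller
     [H j] or an overlap would break the cover. *)
  have dj j : #|F| * #|D j| <= (#|F| - 1) * #|H j|.
    have := linear_capI_card (linH j) (linH i) linM (sH j) (sH i).
    rewrite -hi mulnAC leq_pmul2r// => hc.
    by have := cardsID (H i) (H j); rewrite -/(D j); nia.
  have MD : #|M :\: H i| = (#|F| - 1) * #|H i|.
    by have := cardsID (H i) M; rewrite (setIidPr (sH i)); nia.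
  have sumD : #|F| * (\sum_j #|D j|) <= (#|F| - 1) * (\sum_(j | j != i) #|H j|).
    rewrite (bigD1 i)//= {1}/D setDv cards0 add0n !big_distrr /=.
    by apply: leq_sum.
  have sumH : \sum_(j | j != i) #|H j| <= #|F| * #|H i|.
    have -> : #|F| = \sum_(j | j != i) 1.
      by rewrite sum1_card; have := cardC1 i; rewrite Iq addn1 => ->.
    by rewrite big_distrl /=; apply: leq_sum => j _; rewrite mul1n.
  split=> [j|j k jk].
    have [->//|ji] := eqVneq j i.
    apply/eqP; rewrite eqn_leq hj leqNgt; apply/negP => lt.
    have sumH' : \sum_(j | j != i) #|H j| < #|F| * #|H i|.
      have -> : #|F| = \sum_(j | j != i) 1.
        by rewrite sum1_card; have := cardC1 i; rewrite Iq addn1 => ->.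
      rewrite big_distrl /= (bigD1 j)//= [X in _ < X](bigD1 j)//= mul1n.
      rewrite -addSn leq_add//.
      by apply: leq_sum.
    have := card_cover_leq DM cD; rewrite MD; nia.
  apply/subsetP => x; rewrite inE => /andP[xj xk].
  apply: contraT => xi.
  have := card_overcover_ltn (x := x) DM cD jk.
  rewrite !inE xi xj xk MD => /(_ erefl erefl); nia.
have [eqH _] := key _ hi0.
have hi i : #|F| * #|H i| = #|M| by rewrite eqH.
split=> [i j ij|i j k]; last exact: (key k (hi k)).2.
have h0 : 0 < #|H j| by have := hi j; nia.
have := linear_capI_card (linH i) (linH j) linM (sH i) (sH j).
rewrite -(hi j) mulnAC leq_pmul2r// => hc.
by rewrite hi -(hi i) -mulnn -mulnA leq_mul2l hc orbT.
Qed.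

(** * Families of subspaces with the same incidence function *)

(** Sequences make equality up to order a [perm_eq] and allow a common member to be removed. *)
Definition same_incidence (s t : seq {set 'rV[F]_n}) : Prop :=
  forall x, count (fun X => x \in X) s = count (fun X => x \in X) t.

Lemma same_incidence_size s t :
  {in s, forall X, linear_set X} -> {in t, forall X, linear_set X} ->
  same_incidence s t -> size s = size t.
Proof.
move=> ls lt /(_ 0%R).
have cnt u : {in u, forall X, linear_set X} ->
    count (fun X : {set 'rV[F]_n} => 0%R \in X) u = size u.
  by move=> lu; apply/eqP; rewrite -all_count; apply/allP => X /lu/linear_set0.
by rewrite !cnt.
Qed.

(** If [M] were not in [t], its traces on the members of [t] would be proper, since none of these is
    larger than [M]. They cover [M] because every point of [M] is counted in [s], hence in [t]; but
    at most q proper subspaces cannot cover. *)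
Lemma largest_mem s t M :
  {in s, forall X, linear_set X} -> {in t, forall X, linear_set X} ->
  same_incidence s t -> M \in s -> {in t, forall X, #|X| <= #|M|} ->
  size t <= #|F| -> M \in t.
Proof.
move=> ls lt st Ms Mmax; rewrite leqNgt => /negP tq.
apply: contraT => Mt; case: tq.
rewrite -[X in _ < X]card_ord.
apply: (@linear_cover_gt _ (fun i : 'I_(size t) => M :&: tnth (in_tuple t) i) M).
- exact: ls.
- by move=> i; apply: linear_setI; [exact: ls|apply: lt; exact: mem_tnth].
- move=> i; rewrite properEneq subsetIl andbT; apply: contra Mt => /eqP/setIidPl.
  set X := tnth _ _ => MX; have Xt : X \in t by exact: mem_tnth.
  by suff -> : M = X by []; apply/eqP; rewrite eqEcard MX Mmax.
- move=> x xM.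
  have : has (fun X => x \in X) t.
    by rewrite has_count -st -has_count; apply/hasP; exists M.
  move=> /hasP[X /(tnthP (in_tuple t))[i ->] xX].
  by exists i; rewrite inE xM.
Qed.

(** A member of largest order in either family belongs to both; remove it from both and induct on
    the length. *)
Lemma short_solution_perm s t :
  {in s, forall X, linear_set X} -> {in t, forall X, linear_set X} ->
  same_incidence s t -> size s <= #|F| -> perm_eq s t.
Proof.
elim: {s}(size s) {-2}s (erefl (size s)) t => [|N IH] s sN t ls lt st sq.
  have := same_incidence_size ls lt st; rewrite sN => /esym/size0nil ->.
  by rewrite (size0nil sN).
have stN := same_incidence_size ls lt st.
have [M Mst Mmax] : exists2 M, M \in s ++ t & {in s ++ t, forall X, #|X| <= #|M|}.
  have u0 : 0 < size (s ++ t) by rewrite size_cat sN.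
  case: (@arg_maxnP _ (Ordinal u0) predT
    (fun i => #|tnth (in_tuple (s ++ t)) i|)) => // i _ imax.
  exists (tnth (in_tuple (s ++ t)) i); first exact: mem_tnth.
  by move=> X /(tnthP (in_tuple (s ++ t)))[j ->]; exact: imax.
have [Ms Mt] : M \in s /\ M \in t.
  move: Mst; rewrite mem_cat => /orP[Ms|Mt]; split=> //.
    apply: (largest_mem ls lt st Ms); last by rewrite -stN.
    by move=> X Xt; apply: Mmax; rewrite mem_cat Xt orbT.
  apply: (largest_mem lt ls (fun x => esym (st x)) Mt) => //.
  by move=> X Xs; apply: Mmax; rewrite mem_cat Xs.
have ps := perm_to_rem Ms; have pt := perm_to_rem Mt.
rewrite (permPl ps) (permPr pt) perm_cons.
apply: IH.
- by rewrite size_rem// sN.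
- by move=> X /mem_rem/ls.
- by move=> X /mem_rem/lt.
- move=> x; have := st x.
  by rewrite (seq.permP ps) (seq.permP pt) /= => /addnI.
- by rewrite size_rem// (leq_trans (leq_pred _)).
Qed.

(** Removing a common member would leave two families of length q, which are permutations of each
    other by [short_solution_perm]. *)
Lemma solution_disjoint s t :
  {in s, forall X, linear_set X} -> {in t, forall X, linear_set X} ->
  same_incidence s t -> size s = #|F| + 1 -> ~~ perm_eq s t ->
  {in s, forall X, X \notin t}.
Proof.
move=> ls lt st sq nst X Xs; apply: contra nst => Xt.
have ps := perm_to_rem Xs; have pt := perm_to_rem Xt.
rewrite (permPl ps) (permPr pt) perm_cons.
apply: short_solution_perm.
- by move=> Y /mem_rem/ls.
- by move=> Y /mem_rem/lt.
- move=> x; have := st x.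
  by rewrite (seq.permP ps) (seq.permP pt) /= => /addnI.
- by rewrite size_rem// sq addn1.
Qed.

(** * The common core of two families *)

Definition core (I : finType) (A B : I -> {set 'rV[F]_n}) : {set 'rV[F]_n} :=
  [set x | [forall i, (x \in A i) && (x \in B i)]].

Lemma coreC (I : finType) (A B : I -> {set 'rV[F]_n}) : core A B = core B A.
Proof.
by apply/setP => x; rewrite !inE; apply: eq_forallb => i; rewrite andbC.
Qed.

Lemma core_subset (I : finType) (A B : I -> {set 'rV[F]_n}) i :
  core A B \subset A i /\ core A B \subset B i.
Proof.
by split; apply/subsetP => x; rewrite inE => /forallP/(_ i)/andP[].
Qed.

(** The traces of the [B j] on [A i] are proper and cover [A i], so [linear_cover_tight] applies: a
    point of [A i] in two of the [B j] lies in all of them, and by equal incidence in all the [A j].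
    A point of [A i] in a second [A j] also lies in two of the [B j]. *)
Lemma dominant_core (I : finType) (A B : I -> {set 'rV[F]_n}) (i : I) :
  (forall j, linear_set (A j)) -> (forall j, linear_set (B j)) ->
  #|I| = #|F| + 1 ->
  (forall x, #|[set j | x \in A j]| = #|[set j | x \in B j]|) ->
  (forall j, ~~ (A i \subset B j)) ->
  [/\ forall j, j != i -> A i :&: A j \subset core A B,
      forall j k, j != k -> A i :&: B j :&: B k \subset core A B &
      #|A i| <= #|F| ^ 2 * #|core A B|].
Proof.
move=> lA lB Iq AB nAB.
have [|j|j|x xi|//|card_cap cap] :=
    @linear_cover_tight _ (fun j => A i :&: B j) (A i).
- exact: lA.
- exact: linear_setI.
- by rewrite properEneq subsetIl andbT; apply: contra (nAB j) => /eqP/setIidPl.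
- have : 0 < #|[set j | x \in B j]|.
    by rewrite -AB; apply/card_gt0P; exists i; rewrite inE.
  by move=> /card_gt0P[j]; rewrite inE => xj; exists j; rewrite inE xi.
have capE j k : A i :&: B j :&: B k = (A i :&: B j) :&: (A i :&: B k).
  by rewrite setIACA setIid setIA.
have subC j k : j != k -> A i :&: B j :&: B k \subset core A B.
  move=> jk; rewrite capE; apply/subsetP => x xjk.
  have xB l : x \in B l.
    by have /subsetP/(_ _ xjk) := cap j k l jk; rewrite inE => /andP[].
  have xA l : x \in A l.
    have /eqP/setP/(_ l) : [set l | x \in A l] == setT.
      rewrite eqEcard subsetT AB subset_leq_card//.
      by apply/subsetP => m _; rewrite inE.
    by rewrite !inE.
  by rewrite inE; apply/forallP => l; rewrite xA xB.
split=> //.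
  move=> j ji; apply/subsetP => x; rewrite inE => /andP[xi xj].
  have : 1 < #|[set k | x \in B k]|.
    by rewrite -AB; apply/card_gt1P; exists i, j; rewrite !inE xi xj eq_sym.
  move=> /card_gt1P[k [l]]; rewrite !inE => -[xk xl kl].
  by have /subsetP/(_ x) := subC _ _ kl; rewrite !inE xi xk xl => ->.
have : 1 < #|I| by rewrite Iq addn1 ltnS (ltnW finField_gt1).
move=> /card_gt1P[j [k [_ _ jk]]].
apply: leq_trans (card_cap j k jk) _.
by rewrite leq_mul2l -capE subset_leq_card ?orbT// subC.
Qed.

Lemma solution_core (I : finType) (A B : I -> {set 'rV[F]_n}) :
  (forall i, linear_set (A i)) -> (forall i, linear_set (B i)) ->
  #|I| = #|F| + 1 ->
  (forall x, #|[set j | x \in A j]| = #|[set j | x \in B j]|) ->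
  (forall i j, A i != B j) ->
  (forall i j, i != j -> A i :&: A j = core A B) /\
  (forall i, #|A i| <= #|F| ^ 2 * #|core A B|).
Proof.
move=> lA lB Iq AB nAB.
have dA i := dominant_core lA lB Iq AB (i := i).
have dB i := dominant_core lB lA Iq (fun x => esym (AB x)) (i := i).
(* Among the members of both families containing [A i], one of largest order is maximal for
   inclusion. As the families share no member, it lies in no member of the opposite family. *)
have dom i : (exists2 j, A i \subset A j & forall k, ~~ (A j \subset B k)) \/
             (exists2 j, A i \subset B j & forall k, ~~ (B j \subset A k)).
  pose E (z : I * bool) := if z.2 then A z.1 else B z.1.
  case: (@arg_maxnP _ (i, true) (fun z => A i \subset E z) (fun z => #|E z|)).
    by [].
  move=> [j b] iE Emax.
  have trE Z : E (j, b) \subset E Z -> E (j, b) = E Z.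
    move=> jZ; apply/eqP; rewrite eqEcard jZ /=.
    by apply: Emax; exact: subset_trans iE jZ.
  case: b iE Emax trE => iE Emax trE; [left|right]; exists j => // k.
    by apply/negP => /(trE (k, false)) /eqP; exact/negP/nAB.
  by apply/negP => /(trE (k, true)) /esym/eqP; exact/negP/nAB.
split=> [i j ij|i]; last first.
  have [[j ij /dA[_ _ h]]|[j ij /dB[_ _ h]]] := dom i.
    exact: leq_trans (subset_leq_card ij) h.
  by apply: leq_trans (subset_leq_card ij) _; rewrite coreC.
apply/eqP; rewrite eqEsubset subsetI !(core_subset _ _ _).1 !andbT.
(* If [A k] is dominated by another [A l], then [A k] equals its intersection with [A l] and already
   lies in the core. Only domination by some [B l] remains. *)
have dom' k : (forall l, l != k -> A k :&: A l \subset core A B) \/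
    (exists2 l, A k \subset B l & forall m, ~~ (B l \subset A m)).
  have [[l kl lB']|[l kl lA']] := dom k; [left|by right; exists l].
  move=> m mk; have [lk|lk] := eqVneq l k.
    by rewrite lk in lB'; have [h _ _] := dA _ lB'; apply: h.
  have [h _ _] := dA _ lB'; apply: subset_trans (subsetIl _ _) _.
  by apply: subset_trans (h k _); rewrite 1?eq_sym// subsetI kl subxx.
have [h|[k ik nk]] := dom' i; first by apply: h; rewrite eq_sym.
have [h|[l jl nl]] := dom' j; first by rewrite setIC; apply: h.
(* Now [A i] lies in [B k] and [A j] in [B l]. If k = l, the intersection is a double trace on
   [B k]; otherwise it lies in the intersection of two distinct [B]. *)
rewrite coreC; have [kl|kl] := eqVneq k l.
  subst l; have [_ h _] := dB _ nk; apply: subset_trans (h i j ij).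
  by rewrite subsetI subsetIr andbT subsetI subsetIl (subset_trans (subsetIl _ _) ik).
have [h _ _] := dB _ nk; apply: subset_trans (h l _); last by rewrite eq_sym.
by rewrite setISS.
Qed.

End Covers.

(** * Annihilators *)

Section Duality.
Variables (F : finFieldType) (n : nat).
Implicit Types A B : 'M[F]_n.

(** Functionals are identified with row vectors by the standard pairing, so annihilators stay in the
    same space and can be iterated. *)
Definition annihilator A : 'M[F]_n := kermx A^T.

Lemma sub_annihilator m (u : 'M_(m, n)) A :
  (u <= annihilator A)%MS = (A <= kermx u^T)%MS.
Proof. by rewrite !sub_kermx -trmx_eq0 trmx_mul trmxK. Qed.

Lemma mxrank_annihilator A : \rank (annihilator A) = n - \rank A.
Proof. by rewrite mxrank_ker mxrank_tr. Qed.

Lemma annihilatorK A : (annihilator (annihilator A) :=: A)%MS.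
Proof.
have le : (A <= annihilator (annihilator A))%MS by rewrite sub_annihilator.
apply/eqmx_sym/eqmxP; rewrite -(mxrank_leqif_eq le) !mxrank_annihilator subKn//.
exact: rank_leq_row.
Qed.

Lemma annihilatorS A B :
  (annihilator B <= annihilator A)%MS = (A <= B)%MS.
Proof. by rewrite sub_annihilator -/(annihilator _) annihilatorK. Qed.

Lemma eqmx_annihilator A B :
  (A :=: B)%MS -> (annihilator A :=: annihilator B)%MS.
Proof. by move=> /eqmxP AB; apply/eqmxP; rewrite !annihilatorS andbC. Qed.

Lemma annihilator_adds A B :
  rowg (annihilator (A + B)%MS) = rowg (annihilator A) :&: rowg (annihilator B).
Proof.
apply/setP => u; rewrite in_setI !mem_rowg.
by rewrite (sub_annihilator u (A + B)%MS) 2!sub_annihilator addsmx_sub.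
Qed.

(** When [f] does not vanish on [A], the section is proper, hence of index at least q, and the
    kernel of [f] has codimension at most 1, hence of index at most q. *)
Lemma card_hyperplane_section A (f : 'rV[F]_n) :
  #|F| * #|rowg A :&: rowg (kermx f^T)| =
  (if f \in rowg (annihilator A) then #|F| else 1) * #|rowg A|.
Proof.
rewrite mem_rowg sub_annihilator -rowgS; have [/setIidPl -> //|nAf] := ifPn.
have linA : linear_set (rowg A) by exists A.
have linf : linear_set (rowg (kermx f^T)) by exists (kermx f^T).
rewrite mul1n; apply/eqP; rewrite eqn_leq; apply/andP; split.
  apply: linear_proper_card => //; first exact: linear_setI.
  by rewrite properEneq subsetIl andbT; apply: contra nAf => /eqP/setIidPl.
have linT : linear_set [set: 'rV[F]_n] by exists 1%:M%R; rewrite rowg1.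
have := linear_capI_card linA linf linT (subsetT _) (subsetT _).
have nf : #|[set: 'rV[F]_n]| <= #|F| * #|rowg (kermx f^T)|.
  rewrite -rowg1 !card_rowg -expnS leq_exp2l ?finField_gt1// mxrank1.
  by rewrite mxrank_ker mxrank_tr; have := rank_leq_row f; lia.
have f0 : 0 < #|rowg (kermx f^T)| by rewrite card_rowg expn_gt0 ltnW ?finField_gt1.
move=> h; rewrite -(leq_pmul2r f0); apply: leq_trans h _.
by rewrite [leqRHS]mulnAC leq_mul2r nf orbT.
Qed.

(* Summing over the hyperplane [f = 0] plays the role of the Fourier transform:
   [A] contributes 1 if [f] annihilates [A], and [1 / #|F|] otherwise. *)
Lemma incidence_annihilator (I : finType) (A B : I -> 'M[F]_n) :
  (forall x, \sum_i (#|rowg (A i)|%:R)^-1 * (x \in rowg (A i))%:R =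
             \sum_i (#|rowg (B i)|%:R)^-1 * (x \in rowg (B i))%:R :> rat)%R ->
  forall f, #|[set i | f \in rowg (annihilator (A i))]| =
            #|[set i | f \in rowg (annihilator (B i))]|.
Proof.
move=> AB f.
have key (C : I -> 'M[F]_n) :
    (#|F|%:R * \sum_(x in rowg (kermx f^T))
      \sum_i (#|rowg (C i)|%:R)^-1 * (x \in rowg (C i))%:R =
    #|I|%:R + (#|F|%:R - 1) * #|[set i | f \in rowg (annihilator (C i))]|%:R
      :> rat)%R.
  have -> : (#|I|%:R = \sum_(i : I) 1 :> rat)%R by rewrite -sum1_card natr_sum.
  rewrite -sum1dep_card natr_sum exchange_big !mulr_sumr.
  rewrite [X in (_ = _ + X)%R]big_mkcond -big_split.
  apply: eq_bigr => i _ /=.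
  rewrite -mulr_sumr -natr_sum.
  have -> : (\sum_(x in rowg (kermx f^T)) (x \in rowg (C i)))%N =
      #|rowg (C i) :&: rowg (kermx f^T)|.
    rewrite -sum1_card big_mkcond [RHS]big_mkcond; apply: eq_bigr => x _.
    by rewrite in_setI andbC; case: ifP => //=; case: ifP.
  have C0 : (#|rowg (C i)|%:R != 0 :> rat)%R.
    by rewrite pnatr_eq0 -lt0n card_rowg expn_gt0 ltnW ?finField_gt1.
  rewrite mulrCA -natrM card_hyperplane_section natrM mulrCA mulVf// mulr1.
  by case: ifP => _; rewrite ?mulr1 ?mulr0 ?addr0// addrC subrK.
(* Cancelling [#|I|] and the nonzero factor q - 1 leaves the two counts. *)
have := key B; rewrite -(eq_bigr _ (fun x _ => AB x)) key => /addrI/mulfI => /(_ _)/eqP.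
rewrite eqr_nat => h; apply/eqP/h.
by rewrite subr_eq0 (eqr_nat _ _ 1) gtn_eqF// finField_gt1.
Qed.

Lemma matrix_solution_sum (I : finType) (A B : I -> 'M[F]_n) :
  #|I| = #|F| + 1 ->
  (forall x, \sum_i (#|rowg (A i)|%:R)^-1 * (x \in rowg (A i))%:R =
             \sum_i (#|rowg (B i)|%:R)^-1 * (x \in rowg (B i))%:R :> rat)%R ->
  ~~ perm_eq [seq rowg (A i) | i <- enum I] [seq rowg (B i) | i <- enum I] ->
  forall i j, i != j ->
  (forall k, (A k <= A i + A j)%MS /\ (B k <= A i + A j)%MS) /\
  #|rowg (A i + A j)%MS| <= #|F| ^ 2 * #|rowg (A i)|.
Proof.
move=> Iq AB nAB.
pose A' i := rowg (annihilator (A i)); pose B' i := rowg (annihilator (B i)).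
have lA i : linear_set (A' i) by exists (annihilator (A i)).
have lB i : linear_set (B' i) by exists (annihilator (B i)).
have cAB := incidence_annihilator AB.
(* A row space is recovered from its annihilator as a set, so a permutation matching the
   annihilators would match the original families. *)
have dualK C : rowg (annihilator (rowg_mx (rowg (annihilator C)))) = rowg C.
  apply: eq_rowg; apply: eqmx_trans (annihilatorK C).
  exact/eqmx_annihilator/rowgK.
have countE (C : I -> {set 'rV[F]_n}) x :
    count (fun X : {set 'rV[F]_n} => x \in X) [seq C i | i <- enum I] =
    #|[set i | x \in C i]|.
  rewrite count_map -size_filter enumT cardE; congr size.
  by apply: eq_filter => i; rewrite !inE.
have disj i j : A' i != B' j.
  have memA : A' i \in [seq A' i | i <- enum I] by rewrite map_f ?mem_enum.
  have memB : B' j \in [seq B' i | i <- enum I] by rewrite map_f ?mem_enum.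
  apply: contraTneq memB => <-.
  apply: (@solution_disjoint F n _ _ _ _ _ _ _ _ memA).
  - by move=> _ /mapP[k _ ->].
  - by move=> _ /mapP[k _ ->].
  - by move=> x; rewrite !countE cAB.
  - by rewrite size_map -cardE.
  - apply: contra nAB => /(perm_map (fun X => rowg (annihilator (rowg_mx X)))).
    by rewrite -!map_comp !(eq_map (fun i => dualK _)).
move=> i j ij.
have [cap card] := solution_core lA lB Iq cAB disj.
have capE : rowg (annihilator (A i + A j)%MS) = core A' B'.
  by rewrite annihilator_adds cap.
split=> [k|].
  by rewrite -!(annihilatorS _ (A i + A j)%MS) -!rowgS capE; apply: core_subset.
(* With the core as annihilator of the sum, |A i + A j| |core| = q^n = |A i| |A' i| <= |A i| q^2
   |core|. *)
have cardE C : #|rowg C| * #|rowg (annihilator C)| = #|F| ^ n.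
  by rewrite !card_rowg -expnD mxrank_annihilator subnKC// rank_leq_row.
have core0 : 0 < #|core A' B'|.
  by rewrite -capE card_rowg expn_gt0 ltnW ?finField_gt1.
rewrite -(leq_pmul2r core0) -{1}capE cardE -(cardE (A i)).
by rewrite -mulnA mulnCA leq_mul2l card orbT.
Qed.

End Duality.

(** * Coordinates *)

Section Presentation.
Variables (F : finFieldType) (W : lmodType F) (n : nat) (e : 'I_n -> W).
Implicit Types X Y : {pred W}.
Local Open Scope ring_scope.

(** The family [e] may be dependent. The kernel of this map then lies in the pullback of every
    subspace. *)
Definition combination (a : 'rV[F]_n) : W := \sum_i a 0 i *: e i.

Lemma combination_is_linear : linear combination.
Proof.
move=> c a b; rewrite /combination scaler_sumr -big_split; apply: eq_bigr => i _ /=.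
by rewrite !mxE scalerDl scalerA.
Qed.

HB.instance Definition _ :=
  GRing.isLinear.Build F 'rV[F]_n W _ combination combination_is_linear.

Lemma combination_delta i : combination (delta_mx 0 i) = e i.
Proof.
rewrite /combination (bigD1 i)//= mxE !eqxx scale1r big1 ?addr0// => j ji.
by rewrite mxE eqxx (negPf ji) scale0r.
Qed.

Definition pullback X : {set 'rV[F]_n} := [set a | combination a \in X].

Definition pullback_mx X : 'M[F]_n := rowg_mx (pullback X).

Lemma rowg_pullback X :
  GRing.submod_closed X -> rowg (pullback_mx X) = pullback X.
Proof.
move=> [X0 Xlin]; apply/eqP; rewrite eqEsubset sub_rowg_mx andbT.
apply/subsetP => v; rewrite !inE genmxE => /submxP[w ->].
rewrite mulmx_sum_row linear_sum.
apply: (big_ind (fun x => x \in X)) => // [x y Xx Xy|i _].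
  by rewrite -[x]scale1r; exact: Xlin.
rewrite linearZ /= -[_ *: _]addr0; apply: Xlin => //.
by have := enum_valP i; rewrite inE rowK.
Qed.

Lemma pullback_subset X Y : {subset X <= codom combination} ->
  pullback X \subset pullback Y -> {subset X <= Y}.
Proof.
move=> sX sXY w Xw; have /codomP[a aw] := sX w Xw.
by have /subsetP/(_ a) := sXY; rewrite !inE -aw; apply.
Qed.

(** The fibres over points of [X] are translates of the kernel, which is the pullback of
    [pred1 0]. *)
Lemma card_pullback X (s : seq W) :
  {subset X <= codom combination} -> uniq s -> s =i X ->
  #|pullback X| = (#|pullback (pred1 0%R)| * size s)%N.
Proof.
move=> sX us sE.
have fiber w : w \in s -> #|pullback (pred1 w)| = #|pullback (pred1 0%R)|.
  rewrite sE => /sX/codomP[b ->].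
  rewrite -[RHS](card_imset _ (addrI b)); apply: eq_card => a.
  apply/idP/imsetP => [|[c]]; rewrite !inE.
    move=> /eqP ab; exists (a - b); last by rewrite addrC subrK.
    by rewrite !inE linearB /= ab subrr.
  by move=> /eqP c0 ->; rewrite linearD /= c0 addr0.
transitivity (\sum_(w <- s) #|pullback (pred1 w)|)%N; last first.
  rewrite (eq_big_seq _ fiber) big_const_seq iter_addn_0 count_predT.
  by [].
under eq_bigr do rewrite -sum1dep_card big_mkcond.
rewrite exchange_big -sum1dep_card big_mkcond; apply: eq_bigr => a _ /=.
transitivity (count_mem (combination a) s).
  by rewrite count_uniq_mem// sE; case: (_ \in X).
by rewrite -sum1_count big_mkcond; apply: eq_bigr => w _; rewrite inE eq_sym.
Qed.

(** If [a] maps to x + y and [b] is a lift of x, then [a - b] maps to y, so the kernel is absorbed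
    in the pullback of [Y]. *)
Lemma pullback_add X Y Z :
  GRing.submod_closed X -> GRing.submod_closed Y ->
  {subset X <= codom combination} ->
  (forall z, reflect (exists x y, [/\ x \in X, y \in Y & z = x + y]) (z \in Z)) ->
  pullback Z = rowg (pullback_mx X + pullback_mx Y)%MS.
Proof.
move=> cX cY sX ZP; apply/eqP; rewrite eqEsubset; apply/andP; split.
  apply/subsetP => a; rewrite inE => /ZP[x [y [Xx Yy axy]]].
  have /codomP[b bx] := sX x Xx.
  rewrite mem_rowg -[a](subrK b) addrC; apply: addmx_sub_adds.
    by rewrite -mem_rowg rowg_pullback// inE -bx.
  rewrite -mem_rowg rowg_pullback// inE linearB /= axy -bx.
  by rewrite addrAC subrr add0r.
apply/subsetP => a; rewrite mem_rowg => /sub_addsmxP[[u v] /= ->].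
rewrite inE; apply/ZP; exists (combination (u *m pullback_mx X)).
exists (combination (v *m pullback_mx Y)); split; last by rewrite linearD.
  have : u *m pullback_mx X \in rowg (pullback_mx X).
    by rewrite mem_rowg submxMl.
  by rewrite rowg_pullback// inE.
have : v *m pullback_mx Y \in rowg (pullback_mx Y).
  by rewrite mem_rowg submxMl.
by rewrite rowg_pullback// inE.
Qed.

End Presentation.

From mathcomp Require Import finmap.
From mathcomp Require Import boolp classical_sets functions cardinality.
From mathcomp Require Import numfun.

(** * Dimension and cardinality *)

Section Cardinality.
Variables (K : finFieldType) (W : lmodType K).
Implicit Types X B : set W.
Local Open Scope ring_scope.
Local Open Scope classical_set_scope.

(** Taking coordinates in [B] identifies [X] with the functions from [B] to [K]. *)
Lemma basis_card X B : finite_set B -> is_basis X B ->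
  finite_set X /\ #|` fset_set X| = (#|K| ^ #|` fset_set B|)%N.
Proof.
move=> finB [indB spanB]; set s := fset_set B.
have sB w : w \in s -> B w by rewrite in_fset_set// inE.
pose psi (a : {ffun s -> K}) : W := \sum_x a x *: val x.
have psiE (c : W -> K) : psi [ffun x => c (val x)] = \sum_(x <- s) c x *: x.
  by rewrite big_seq_fsetE; apply: eq_bigr => x _; rewrite ffunE.
have psi_inj : injective psi.
  move=> a b ab.
  (* [lin_indep] speaks of coefficients on all of [W], so the difference is extended by zero outside
     [s]. *)
  pose c w := if insub w is Some x then a x - b x else 0.
  have cE x : c (val x) = a x - b x by rewrite /c valK.
  have c0 : \sum_(x <- s) c x *: x = 0.
    rewrite -psiE; transitivity (psi a - psi b); last by rewrite ab subrr.
    rewrite /psi -sumrB; apply: eq_bigr => x _.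
    by rewrite ffunE cE scalerBl.
  apply/ffunP => x; apply/eqP; rewrite -subr_eq0 -cE; apply/eqP.
  by apply: (indB s c _ c0); [move=> w /= /sB|exact: valP].
have rangeE : X = range psi.
  rewrite -spanB; apply/seteqP; split=> [_ [t [c [tB ->]]]|_ [a _ <-]].
    exists [ffun x => if val x \in t then c (val x) else 0] => //.
    rewrite (psiE (fun x => if x \in t then c x else 0)).
    have ts : (t `<=` s)%fset.
      by apply/fsubsetP => x xt; rewrite in_fset_set// inE; exact: tB.
    rewrite -(big_fset_incl _ ts) => [|x _ /negPf ->]; last by rewrite scale0r.
    by apply: eq_big_seq => x ->.
  exists s, (fun w => if insub w is Some x then a x else 0); split=> [w /= /sB //|].
  by rewrite big_seq_fsetE; apply: eq_bigr => x _ /=; rewrite valK.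
have finX : finite_set X by rewrite rangeE; exact: finite_image.
split=> //.
transitivity (size [seq psi a | a <- enum {ffun s -> K}]).
  apply: perm_size; apply: uniq_perm.
  - exact: fset_uniq.
  - by rewrite map_inj_uniq ?enum_uniq.
  - move=> w; rewrite in_fset_set//; apply/idP/mapP.
      by rewrite inE rangeE => -[a _ <-]; exists a; rewrite ?mem_enum.
    by move=> [a _ ->]; rewrite inE rangeE; exists a.
by rewrite size_map -cardE card_ffun -cardfE.
Qed.

Lemma basis_subset X B : is_basis X B -> B `<=` X.
Proof.
move=> [_ <-] x Bx; exists [fset x]%fset, (fun=> 1); split.
  by move=> y /=; rewrite inE => /eqP ->.
by rewrite big_seq_fset1 scale1r.
Qed.

(** The basis picked by [xget] may differ from the given finite one; it is finite because it lies in
    [X], which the given basis shows to be finite. *)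
Lemma fin_dim_card X : fin_dim X ->
  finite_set X /\ #|` fset_set X| = (#|K| ^ subspace_dim X)%N.
Proof.
move=> [B0 finB0 bB0]; have [finX _] := basis_card finB0 bB0.
have bB : is_basis X (xget set0 [set B | is_basis X B]).
  by apply: (@xgetPex _ set0 [set B | is_basis X B]); exists B0.
apply: basis_card => //; exact: sub_finite_set (basis_subset bB) finX.
Qed.

(* If [X] had no basis, [subspace_dim X] would be 0. *)
Lemma expn_subspace_dim_le X : finite_set X -> X 0 ->
  (#|K| ^ subspace_dim X <= #|` fset_set X|)%N.
Proof.
move=> finX X0; rewrite /subspace_dim; case: xgetP => [B _ bB|_].
  have [_ ->//] := basis_card (sub_finite_set (basis_subset bB) finX) bB.
by rewrite fset_set0 cardfs0 expn0 cardfs_gt0; apply/fset0Pn; exists 0;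
  rewrite in_fset_set// inE.
Qed.

End Cardinality.

(** * Transfer of the solution to coordinates *)

Local Open Scope classical_set_scope.

Theorem proposition7 (K : finFieldType) (q : nat) (hq : #|K| = q)
    (W : lmodType K) (hW : full_dim_gt1 W)
    (m : nat) (hm : m = (q + 1)%N)
    (U V : 'I_m -> set W)
    (hU : forall i, is_subspace (U i) /\ fin_dim (U i))
    (hV : forall i, is_subspace (V i) /\ fin_dim (V i))
    (hUV : nontrivial_solution U V) :
  (forall i j : 'I_m, i <> j -> forall k : 'I_m,
     V k `<=` sum_space (V i) (V j) /\ U k `<=` sum_space (V i) (V j)) /\
  (forall i j : 'I_m, i <> j ->
     (subspace_dim (sum_space (V i) (V j))
      <= 2 + \max_(l < m) subspace_dim (V l))%N).
Proof.
have [isoUV ntUV] := hUV.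
(* All vectors of all members, repetitions included, serve as generators: each is the image of a
   unit row, so every member lies in the image of [combination e]. *)
pose L := flatten [seq (fset_set (V i) : seq W) ++ fset_set (U i) | i <- enum 'I_m].
pose e := tnth (in_tuple L).
have [finV cardV] := all_and2 (fun i => fin_dim_card (hV i).2).
have [finU _] := all_and2 (fun i => fin_dim_card (hU i).2).
have codL w : w \in L -> w \in codom (combination e).
  move=> /(tnthP (in_tuple L))[i ->]; apply/codomP.
  by exists (delta_mx 0 i)%R; rewrite combination_delta.
have sV i : {subset [in V i] <= codom (combination e)}.
  move=> w Vw; apply: codL; apply/flatten_mapP; exists i; first by rewrite mem_enum.
  by rewrite mem_cat in_fset_set// Vw.
have sU i : {subset [in U i] <= codom (combination e)}.
  move=> w Uw; apply: codL; apply/flatten_mapP; exists i; first by rewrite mem_enum.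
  by rewrite mem_cat orbC in_fset_set// Uw.
(* The kernel order [c] multiplies the order of every member, so pulling back rescales both sides of
   the isometry equation by the same 1/c. *)
pose c := #|pullback e (pred1 0%R)|.
have c0 : (0 < c)%N by apply/card_gt0P; exists 0%R; rewrite !inE linear0.
have cardX (X : set W) : finite_set X -> {subset [in X] <= codom (combination e)} ->
    #|pullback e [in X]| = (c * #|` fset_set X|)%N.
  move=> finX sX; apply: card_pullback => //; first exact: fset_uniq.
  by move=> w; rewrite in_fset_set.
have sumE (Z : 'I_m -> set W) :
    (forall i, GRing.submod_closed [in Z i]) -> (forall i, finite_set (Z i)) ->
    (forall i, {subset [in Z i] <= codom (combination e)}) -> forall a,
    (\sum_i (#|rowg (pullback_mx e [in Z i])|%:R)^-1
       * (a \in rowg (pullback_mx e [in Z i]))%:R =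
    c%:R^-1 * weighted_indicator_sum Z (combination e a) :> rat)%R.
  move=> subZ finZ sZ a; rewrite /weighted_indicator_sum mulr_sumr.
  apply: eq_bigr => i _; rewrite rowg_pullback// cardX// natrM invfM -mulrA.
  by rewrite indicE finset.inE.
have subV i : GRing.submod_closed [in V i] := (hV i).1.
have subU i : GRing.submod_closed [in U i] := (hU i).1.
have AB a := etrans (sumE V subV finV sV a)
  (etrans (congr1 (fun f => c%:R^-1 * f (combination e a))%R isoUV)
          (esym (sumE U subU finU sU a))).
have nAB : ~~ perm_eq [seq rowg (pullback_mx e [in V i]) | i <- enum 'I_m]
                      [seq rowg (pullback_mx e [in U i]) | i <- enum 'I_m].
  (* Subspaces inside the image are determined by their pullbacks, so a permutation of the pullbacks
     is one of the tuples. *)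
  apply/negP => pAB; apply: ntUV.
  have /tuple_permP[p pE] : perm_eq
      (mktuple (fun i => rowg (pullback_mx e [in V i])))
      (mktuple (fun i => rowg (pullback_mx e [in U i]))) by [].
  exists p => i.
  have := congr1 (fun t => tnth t i) (val_inj pE).
  rewrite !tnth_mktuple !rowg_pullback// => VU.
  apply/seteqP; split=> w.
    have := pullback_subset (sV i) (Y := [in U (p i)]).
    by rewrite VU => /(_ (subxx _))/(_ w); rewrite !inE.
  have := pullback_subset (sU (p i)) (Y := [in V i]).
  by rewrite VU => /(_ (subxx _))/(_ w); rewrite !inE.
have mq : #|'I_m| = (#|K| + 1)%N by rewrite card_ord hm hq.
have sumP i j z : reflect (exists x y, [/\ x \in [in V i], y \in [in V j] & z = x + y]%R)
    (z \in [in sum_space (V i) (V j)]).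
  apply: (iffP idP).
    by rewrite !inE => -[x Vx [y Vy <-]]; exists x, y; rewrite !inE.
  by move=> [x [y [Vx Vy ->]]]; rewrite !inE in Vx Vy *; exists x => //; exists y.
have addE i j := pullback_add (subV i) (subV j) (sV i) (sumP i j).
have sol i j (ij : i <> j) := matrix_solution_sum mq AB nAB (introN eqP ij).
split=> i j /sol[sub card].
  move=> k; have [] := sub k; rewrite -!rowgS -addE !rowg_pullback//.
  move=> /(pullback_subset (sV k)) Vk /(pullback_subset (sU k)) Uk.
  by split=> w wk; [have := Vk w|have := Uk w]; rewrite !inE; apply.
have finS : finite_set (sum_space (V i) (V j)) by exact: finite_image2.
have sS : {subset [in sum_space (V i) (V j)] <= codom (combination e)}.
  move=> _ /sumP[x [y [/sV/codomP[a ->] /sV/codomP[b ->] ->]]].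
  by rewrite -linearD codom_f.
have S0 : sum_space (V i) (V j) 0%R.
  have [[+ _] [+ _]] := (subV i, subV j); rewrite !inE => Vi0 Vj0.
  by exists 0%R => //; exists 0%R => //; rewrite addr0.
(* The factor [c] cancels, leaving |V i + V j| <= q^2 |V i|. The inequality of
   [expn_subspace_dim_le] then bounds the dimension of the sum without exhibiting a basis of it. *)
move: card; rewrite -addE rowg_pullback// !cardX// mulnCA leq_pmul2l// cardV.
move=> /(leq_trans (expn_subspace_dim_le finS S0)).
rewrite -expnD leq_exp2l ?finField_gt1// => /leq_trans; apply.
by rewrite leq_add2l; exact: leq_bigmax.
Qed.
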